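(* Let $\mathcal P$ be a finite poset. Then $w^*(\mathcal P)\leq |\mathcal P|$, where $w^*(\mathcal P)$ denotes the hypercube-width of $\mathcal P$.
   Context: Natural numbers include $0$, and $[n]=\{1,\dots,n\}$ (with $[0]=\emptyset$). The hypercube $Q_n$ is the power set of $[n]$ partially ordered by inclusion. For natural numbers $w,h$, $\binom{[w]}{\leq h}$ denotes the induced subposet of $Q_w$ consisting of all subsets of $[w]$ of size at most $h$. An induced copy of a poset $(\mathcal P,\preceq)$ in a family of sets $\mathcal F$ (ordered by inclusion) is the image of an injective map $\phi:\mathcal P\to\mathcal F$ such that for all $p,q\in\mathcal P$, $p\preceq q$ if and only if $\phi(p)\subseteq\phi(q)$. The hypercube-height $h^*(\mathcal P)$ is the minimum $h\in\mathbb N$ for which there exists $n\in\mathbb N$ such that $\binom{[n]}{\leq h}$ contains an induced copy of $\mathcal P$. (Such $h$ exists for every finite poset.) The hypercube-width $w^*(\mathcal P)$ is the minimum $w\in\mathbb N$ such that $\binom{[w]}{\leq h^*(\mathcal P)}$ contains an induced copy of $\mathcal P$. *)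

(* Defs.v *)
From HB Require Import structures.
From mathcomp Require Import all_boot all_order.
From mathcomp Require Import boolp.

Set Implicit Arguments.
Unset Strict Implicit.
Unset Printing Implicit Defensive.

Import Order.TTheory.

(* The hypercube Q_w is {set 'I_w} ordered by \subset; the ground set [w] is
   represented by 'I_w, that is {0, ..., w - 1}. *)
Definition subsets_le (w h : nat) : {set {set 'I_w}} :=
  [set A : {set 'I_w} | #|A| <= h].

Definition contains_induced_copy (d : Order.disp_t) (P : finPOrderType d)
    (T : finType) (F : {set {set T}}) : Prop :=
  exists phi : P -> {set T},
    [/\ injective phi,
        forall p : P, phi p \in F
      & forall p q : P, (p <= q)%O <-> phi p \subset phi q].

Definition fits_height (d : Order.disp_t) (P : finPOrderType d) (h : nat) :
  Prop := exists n : nat, contains_induced_copy P (subsets_le n h).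

(* Witness: p is sent to its principal down-set, with the elements of P
   numbered by enum_rank. *)
Lemma fits_height_card (d : Order.disp_t) (P : finPOrderType d) :
  fits_height P #|P|.
Proof.
exists #|P|; pose phi (p : P) := [set enum_rank x | x in [pred x | (x <= p)%O]].
have phiE p q : (enum_rank q \in phi p) = (q <= p)%O.
  by rewrite mem_imset ?inE //; exact: enum_rank_inj.
have phi_le p q : (p <= q)%O <-> phi p \subset phi q.
  split=> [le_pq | /subsetP/(_ (enum_rank p))].
    apply/subsetP=> _ /imsetP[x le_xp ->]; rewrite phiE.
    by apply: le_trans le_pq; move: le_xp; rewrite inE.
  by rewrite !phiE lexx; apply.
exists phi; split=> // [p q eq_pq | p].
  by apply/le_anti/andP; split; apply/phi_le; rewrite eq_pq.
by rewrite inE -[X in _ <= X]card_ord max_card.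
Qed.

Lemma ex_height (d : Order.disp_t) (P : finPOrderType d) :
  exists h : nat, `[< fits_height P h >].
Proof. by exists #|P|; apply/asboolP; exact: fits_height_card. Qed.

Definition hypercube_height (d : Order.disp_t) (P : finPOrderType d) : nat :=
  ex_minn (ex_height P).

Lemma ex_width (d : Order.disp_t) (P : finPOrderType d) :
  exists w : nat,
    `[< contains_induced_copy P (subsets_le w (hypercube_height P)) >].
Proof.
rewrite /hypercube_height; case: ex_minnP => h /asboolP[w Pw] _.
by exists w; apply/asboolP.
Qed.

Definition hypercube_width (d : Order.disp_t) (P : finPOrderType d) : nat :=
  ex_minn (ex_width P).

(* Main.v *)
Require Import Defs.
From HB Require Import structures.
From mathcomp Require Import all_boot all_order.
From mathcomp Require Import boolp.
From mathcomp Require Import zify.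

Set Implicit Arguments.
Unset Strict Implicit.
Unset Printing Implicit Defensive.

(** Let phi embed P into subsets of [n] of size at most h, and for S a subset
of P let N(S) be the union of the phi p, p in S.  Choose S minimising
|N(S)| + |P \ S|; this value is at most |P|, as S = set0 shows.  By minimality
the sets phi p \ N(S), for p outside S, satisfy Hall's condition, so they have
distinct representatives g p.  Replacing phi p by
(phi p :&: N(S)) :|: {g q | q <= p, q \notin S}, a subset of phi p, still gives
an induced copy of P: elements of S are separated from the others inside N(S),
and p outside S is separated from every q not above it by g p.  The new copy
only uses the at most |P| points of N(S) and of the image of g. *)

Lemma bigcup_setDl (T I : finType) (S : {set T}) (f : T -> {set I})
    (A : {set I}) :
  \bigcup_(x in S) (f x :\: A) = (\bigcup_(x in S) f x) :\: A.
Proof.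
apply/setP=> i; rewrite inE.
apply/bigcupP/andP => [[x xS]|[iA /bigcupP[x xS ix]]].
  by rewrite inE => /andP[iA ix]; split=> //; apply/bigcupP; exists x.
by exists x => //; rewrite inE iA.
Qed.

Lemma cards_setUD (T : finType) (A B : {set T}) :
  #|A :|: B| = #|A| + #|B :\: A|.
Proof. by rewrite cardsU -(cardsID A B) setIC; lia. Qed.

(** Induction on [#|D|]. A nonempty proper subset [S] that is tight splits the problem into [S] and
    [D :\: S], the latter with the points of [N S] deleted; without such a subset, any point of
    [f x] can be given to one [x]. The point [i0] makes [g] total when [D] is empty. *)
Lemma hall_marriage (T I : finType) (i0 : I) (D : {set T})
    (f : T -> {set I}) :
    (forall S : {set T}, S \subset D -> #|S| <= #|\bigcup_(x in S) f x|) ->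
  exists2 g : T -> I,
    {in D &, injective g} & {in D, forall x, g x \in f x}.
Proof.
have [m] := ubnP #|D|; elim: m D f => // m IHm D f ltDm hallD.
have [->|[x xD]] := set_0Vmem D.
  by exists (fun=> i0) => [y z|y]; rewrite inE.
pose N (S : {set T}) := \bigcup_(y in S) f y.
case: (pickP [pred S : {set T} |
    [&& S != set0, S \proper D & #|N S| <= #|S|]]) => [S|no_tight].
  case/and3P=> S0 ltSD tight; have sSD := proper_sub ltSD.
  have [||g1 g1inj g1f] := IHm S f.
  - by have := proper_card ltSD; lia.
  - by move=> A sAS; apply/hallD/(subset_trans sAS).
  have [||g2 g2inj g2f] := IHm (D :\: S) (fun y => f y :\: N S).
  - have := cardsDS sSD; have := subset_leq_card sSD.
    by move: S0; rewrite -card_gt0; lia.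
  (* Hall's condition for [S :|: A] minus the tight inequality for [S]. *)
  - move=> A; rewrite subsetD => /andP[sAD dAS].
    have := hallD (S :|: A); rewrite subUset sSD sAD => /(_ isT).
    rewrite bigcup_setU bigcup_setDl !cards_setUD -/(N S) -/(N A).
    by rewrite (setDidPl dAS); lia.
  have g1N y : y \in S -> g1 y \in N S.
    by move=> yS; apply/bigcupP; exists y; rewrite ?g1f.
  have g2P y : y \in D -> y \notin S -> g2 y \in f y :\: N S.
    by move=> yD yS; apply: g2f; rewrite inE yS.
  exists (fun y => if y \in S then g1 y else g2 y) => [y z yD zD|y yD].
    case: ifPn => yS; case: ifPn => zS.
    - exact: g1inj.
    - by move=> eq_g; have := g2P z zD zS; rewrite -eq_g inE g1N.
    - by move=> eq_g; have := g2P y yD yS; rewrite eq_g inE g1N.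
    - by apply: g2inj; rewrite inE ?yS ?zS.
  by case: ifPn => yS; [exact: g1f|have := g2P y yD yS; rewrite inE => /andP[]].
have [i ix] : exists i, i \in f x.
  have := hallD [set x]; rewrite sub1set xD big_set1 cards1 => /(_ isT).
  by rewrite card_gt0 => /set0Pn.
have [||g ginj gf] := IHm (D :\ x) (fun y => f y :\ i).
- by move: ltDm; rewrite (cardsD1 x D) xD.
(* A nonempty [A] avoiding [x] is proper in [D], hence not tight: its spare point absorbs the loss
   of [i]. *)
- move=> A sAD; have [->|A0] := eqVneq A set0; first by rewrite cards0.
  have := no_tight A; rewrite /= A0 /= (sub_proper_trans sAD) ?properD1 //=.
  by rewrite bigcup_setDl -/(N A) (cardsD1 i (N A)); lia.
have gP y : y \in D -> y != x -> g y \in f y :\ i.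
  by move=> yD yx; apply: gf; rewrite !inE yx.
exists (fun y => if y == x then i else g y) => [y z yD zD|y yD].
  case: eqVneq => [->|yx]; case: eqVneq => [->|zx] //.
  - by move=> eq_i; have := gP z zD zx; rewrite -eq_i setD11.
  - by move=> eq_i; have := gP y yD yx; rewrite eq_i setD11.
  - by apply: ginj; rewrite !inE ?yx ?zx.
by case: eqVneq => [->//|yx]; have := gP y yD yx; rewrite inE => /andP[].
Qed.

Lemma hall_deficiency (T I : finType) (i0 : I) (f : T -> {set I}) :
  exists S : {set T}, exists g : T -> I,
    [/\ #|\bigcup_(x in S) f x| + #|~: S| <= #|T|,
        {in ~: S &, injective g}
      & {in ~: S, forall x, g x \in f x :\: \bigcup_(y in S) f y}].
Proof.
pose N (S : {set T}) := \bigcup_(y in S) f y.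
case: (@arg_minnP _ set0 xpredT (fun S => #|N S| + #|~: S|)) => // S _ minS.
have [|g ginj gf] := @hall_marriage T I i0 (~: S) (fun x => f x :\: N S).
  (* Moving [A] into [S] lowers [#|~: S|] by [#|A|] and adds [#|N A :\: N S|] to the other term;
     minimality compares the two. *)
  move=> A; rewrite -disjoints_subset => dAS.
  have := minS (S :|: A) isT.
  rewrite /N bigcup_setU bigcup_setDl cards_setUD -/(N S) -/(N A).
  have := cardsC S; have := cardsC (S :|: A).
  by rewrite cards_setUD (setDidPl dAS); lia.
exists S, g; split=> //; apply: leq_trans (minS set0 isT) _.
by rewrite /N big_set0 cards0 max_card.
Qed.

Lemma induced_copy_restrict (d : Order.disp_t) (P : finPOrderType d)
    (n h : nat) (J : {set 'I_n}) (phi : P -> {set 'I_n}) :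
    (forall p, phi p \subset J) -> (forall p, #|phi p| <= h) ->
    (forall p q, (p <= q)%O <-> phi p \subset phi q) ->
  contains_induced_copy P (subsets_le #|J| h).
Proof.
move=> phiJ phih phi_le.
pose psi p := [set k : 'I_#|J| | enum_val k \in phi p].
have psi_le p q : (p <= q)%O <-> psi p \subset psi q.
  rewrite phi_le; split=> /subsetP sub; apply/subsetP.
    by move=> k; rewrite !inE; apply: sub.
  move=> i ip; have iJ := subsetP (phiJ p) i ip.
  have := sub (enum_rank_in iJ i).
  by rewrite !inE enum_rankK_in //; apply.
exists psi; split=> // [p q eq_pq|p].
  by apply/Order.POrderTheory.le_anti/andP; split; apply/psi_le; rewrite eq_pq.
rewrite inE; apply: leq_trans (phih p).
rewrite -(card_imset _ (@enum_val_inj _ (mem J))).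
by apply/subset_leq_card/subsetP=> _ /imsetP[k + ->]; rewrite inE.
Qed.

Lemma induced_copy_shrink (d : Order.disp_t) (P : finPOrderType d)
    (n h : nat) :
    contains_induced_copy P (subsets_le n h) ->
  exists2 w, w <= #|P| & contains_induced_copy P (subsets_le w h).
Proof.
(* For [n = 0] no default point exists, but the given copy already has width 0. *)
case: n => [|n]; first by exists 0.
case=> phi [_ phi_h phi_le].
have [S [g [card_S g_inj gP]]] := hall_deficiency ord0 phi.
set N := \bigcup_(y in S) phi y in card_S gP.
pose G p := [set g q | q in [set q | q \notin S & (q <= p)%O]].
pose psi p := (phi p :&: N) :|: G p.
have psi_phi p : psi p \subset phi p.
  rewrite subUset subsetIl; apply/subsetP=> _ /imsetP[q + ->].
  rewrite inE => /andP[qS /phi_le/subsetP]; apply.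
  by have := gP q; rewrite !inE => /(_ qS)/andP[].
exists #|N :|: g @: ~: S|.
  apply: leq_trans card_S; apply: leq_trans (leq_card_setU _ _) _.
  by rewrite leq_add2l leq_imset_card.
apply: (@induced_copy_restrict _ P _ _ _ psi) => [p|p|p q].
- rewrite setUSS ?subsetIr //; apply/imsetS/subsetP=> q.
  by rewrite !inE => /andP[].
- apply: leq_trans (subset_leq_card (psi_phi p)) _.
  by have := phi_h p; rewrite inE.
split=> [le_pq|sub_pq].
  rewrite setUSS //; first by apply/setSI/phi_le.
  apply/imsetS/subsetP=> r; rewrite !inE => /andP[-> /=] le_rp.
  exact: Order.POrderTheory.le_trans le_pq.
(* Here [phi p] lies inside [N], so it is contained in [psi p], hence in [psi q] and [phi q]. *)
have [pS|pS] := boolP (p \in S).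
  apply/phi_le; apply: subset_trans (psi_phi q); apply: subset_trans sub_pq.
  apply: subset_trans (subsetUl _ _).
  by rewrite subsetI subxx (bigcup_sup p).
(* As [g p] avoids [N], it must equal [g r] for some [r <= q] outside [S]; injectivity gives
   [r = p]. *)
have /(subsetP sub_pq) : g p \in psi p.
  by rewrite inE imset_f ?orbT // inE pS Order.POrderTheory.lexx.
have := gP p; rewrite !inE => /(_ pS)/andP[/negPf-> _].
rewrite andbF => /imsetP[r]; rewrite inE => /andP[rS le_rq] /g_inj.
by rewrite !inE => /(_ pS rS) ->.
Qed.

Theorem theorem4 (d : Order.disp_t) (P : finPOrderType d) :
  hypercube_width P <= #|P|.
Proof.
rewrite /hypercube_width; case: ex_minnP => n /asboolP/induced_copy_shrink.
by case=> w leP copy_w min_n; apply: leq_trans leP; apply/min_n/asboolP.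
Qed.
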